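(* Let $\mathcal{I}$ be a meager ideal on $\mathbf{N}$. Then the set $$\{x \in (0,1] : \Gamma_b^k(x,\mathcal{I}) = \Delta_b^k \text{ for all integers } b\ge 2,\ k\ge 1\}$$ is comeager in $(0,1]$.
   Context: For an integer $b\ge 2$ and $x\in(0,1]$, write $x=\sum_{n\ge 1} d_{b,n}(x)/b^n$ for the unique nonterminating $b$-adic expansion, with digits $d_{b,n}(x)\in\{0,\dots,b-1\}$. Let $S_b^k$ be the set of all strings $\bm{s}=s_1\cdots s_k$ of length $k$ with $s_j\in\{0,\dots,b-1\}$. For $\bm{s}\in S_b^k$ and $n\ge1$ put $\pi_{b,\bm{s},n}(x)=\frac{1}{n}\#\{i\in\{1,\dots,n\}: d_{b,i+j-1}(x)=s_j \text{ for all } j=1,\dots,k\}$, and let $\bm{\pi}^k_{b,n}(x)=(\pi_{b,\bm{s},n}(x):\bm{s}\in S_b^k)\in\mathbf{R}^{b^k}$. Let $\Delta_b^k=\{(p_{\bm{s}})_{\bm{s}\in S_b^k}\in\mathbf{R}^{b^k}: \sum_{\bm{s}}p_{\bm{s}}=1,\ p_{\bm{s}}\ge0 \text{ for all } \bm{s},\ \text{and } \sum_{s_0}p_{s_0\bm{s}}=\sum_{s_k}p_{\bm{s}s_k} \text{ for all } \bm{s}\in S_b^{k-1}\}$, where $s_0\bm{s}$, $\bm{s}s_k$ denote concatenated strings and $s_0,s_k$ range over $\{0,\dots,b-1\}$. An ideal on $\mathbf{N}$ is a family $\mathcal{I}\subseteq\mathcal{P}(\mathbf{N})$ closed under finite unions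 and subsets, containing all finite sets, and different from $\mathcal{P}(\mathbf{N})$. $\mathcal{P}(\mathbf{N})$ carries the Cantor-space topology (identifying subsets with $\{0,1\}^{\mathbf{N}}$); $\mathcal{I}$ is meager if it is a meager subset of this space. For a sequence $(x_n)$ in $\mathbf{R}^d$, a point $\eta$ is an $\mathcal{I}$-cluster point if $\{n\in\mathbf{N}: x_n\in U\}\notin\mathcal{I}$ for every open neighborhood $U$ of $\eta$. $\Gamma_b^k(x,\mathcal{I})$ denotes the set of $\mathcal{I}$-cluster points of the sequence $(\bm{\pi}^k_{b,n}(x):n\ge1)$. *)

(* Defs.v *)
From HB Require Import structures.
From mathcomp Require Import all_boot all_order all_algebra.
From mathcomp Require Import all_classical all_reals all_analysis.
From Stdlib Require Import ClassicalEpsilon.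
Unset Strict Implicit. Unset Printing Implicit Defensive.
Import Order.TTheory GRing.Theory Num.Theory.
Import numFieldNormedType.Exports.
Local Open Scope classical_set_scope.
Local Open Scope ring_scope.

Definition nowhere_dense {T : topologicalType} (A : set T) : Prop :=
  interior (closure A) = set0.

Definition meager {T : topologicalType} (A : set T) : Prop :=
  exists F : nat -> set T, (forall n, nowhere_dense (F n)) /\ A `<=` \bigcup_n F n.

Definition comeager_in {T : topologicalType} (D X : set T) : Prop :=
  @meager (subspace D) (D `\` X).

Definition is_ideal (I : set (set nat)) : Prop :=
  [/\ (forall A B, I A -> I B -> I (A `|` B)),
      (forall A B, B `<=` A -> I A -> I B),
      (forall A, finite_set A -> I A) & I <> setT].

Definition indicator_of (A : set nat) : cantor_space := fun n => `[< A n >].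

Definition meager_ideal (I : set (set nat)) : Prop :=
  meager (indicator_of @` I).

Definition ideal_cluster {T : topologicalType} (I : set (set nat))
  (u : nat -> T) : set T :=
  [set eta | forall U : set T, open U -> U eta -> ~ I [set n | U (u n)]].

Definition is_nonterm_expansion {R : realType} (b : nat) (x : R) (d : nat -> nat) : Prop :=
  [/\ (forall n, (d n < b)%N),
      (fun N => \sum_(1 <= n < N) (d n)%:R / (b%:R ^+ n)) @ \oo --> x
    & (forall N, exists2 n, (N <= n)%N & d n <> 0%N)].

(* the digits d_{b,n}(x) of the unique nonterminating expansion (n >= 1) *)
Definition digits {R : realType} (b : nat) (x : R) : nat -> nat :=
  epsilon (inhabits (fun _ => 0%N)) (is_nonterm_expansion b x).

Definition digit {R : realType} (b n : nat) (x : R) : nat := digits b x n.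

(* strings s = s_1 ... s_k over {0,...,b-1}: k.-tuple 'I_b, s_j = tnth s (j-1) *)
Definition occurs_at {R : realType} (b k : nat) (x : R) (s : k.-tuple 'I_b) (i : nat) : bool :=
  [forall j : 'I_k, digit b (i + j) x == tnth s j].

Definition freq {R : realType} (b k : nat) (x : R) (s : k.-tuple 'I_b) (n : nat) : R :=
  (count (occurs_at b k x s) (iota 1 n))%:R / n%:R.

Definition freq_vec {R : realType} (b k : nat) (x : R) (n : nat) : {ptws k.-tuple 'I_b -> R} :=
  fun s => freq b k x s n.

(* value of p at a string given as a sequence (0 if of wrong length) *)

Definition pseq {R : realType} (b k : nat) (p : k.-tuple 'I_b -> R) (s : seq 'I_b) : R :=
  if insub s is Some t then p t else 0.

Definition Delta (R : realType) (b k : nat) : set {ptws k.-tuple 'I_b -> R} :=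
  [set p | [/\ \sum_(s : k.-tuple 'I_b) p s = 1,
              (forall s, 0 <= p s) &
              (forall s : (k.-1).-tuple 'I_b,
                 \sum_(a : 'I_b) pseq b k p (a :: (s : seq 'I_b))
                 = \sum_(a : 'I_b) pseq b k p (rcons s a))]].

Definition Gamma {R : realType} (b k : nat) (x : R) (I : set (set nat))
  : set {ptws k.-tuple 'I_b -> R} :=
  ideal_cluster I (freq_vec b k x).

(* Main.v *)
Require Import Defs.
From HB Require Import structures.
From mathcomp Require Import all_boot all_order all_algebra.
From mathcomp Require Import all_classical all_reals all_analysis.
From mathcomp Require Import zify ring lra.
From Stdlib Require Import ClassicalEpsilon.
Import Order.TTheory GRing.Theory Num.Theory.
Import numFieldTopology.Exports numFieldNormedType.Exports.
Local Open Scope classical_set_scope.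
Local Open Scope ring_scope.

(** If [I] is meager then (Talagrand, Jalali-Naini) the integers split into
    consecutive finite intervals such that no set containing infinitely many of
    them is in [I]. So a point is an [I]-cluster point as soon as, for each of
    its neighborhoods, the sequence stays in that neighborhood along infinitely
    many entire intervals.

    Given a finite word [w], any finite expansion can be continued by
    [w w w ...]; the block frequencies then converge, up to an error
    [k / |w|], to those of [w], so they remain close to them along an entire
    interval, and this is decided by finitely many digits. Hence, for generic
    [x], the block frequencies of every word [w] are approached along infinitely
    many intervals. Finally these frequencies are dense in [Delta]: its points
    are circulations on the de Bruijn graph, hence nonnegative combinations of
    cycles, and concatenating repetitions of the corresponding periodic words
    approximates such a combination. The inclusion of [Gamma] in [Delta] holds
    for every [x], because the two sides of each linear condition differ by at
    most [1 / n] at time [n]. *)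

(** * Archimedean estimates *)

Lemma large_nat {R : realType} (x eps : R) : 0 < eps ->
  exists M0 : nat, forall M : nat, (M0 <= M)%N -> x <= eps * M%:R.
Proof.
move=> eps0; exists (Num.truncn (x / eps)).+1 => M lM.
rewrite mulrC -ler_pdivrMr//.
by apply: le_trans (ltW (truncnS_gt _)) _; rewrite ler_nat.
Qed.

Lemma eq0_small (R : realType) (z K : R) : 0 <= K ->
  (forall eps, 0 < eps -> `|z| <= K * eps) -> z = 0.
Proof.
move=> K0 zK; apply/eqP; rewrite -normr_le0 leNgt; apply/negP => z0.
have K1 : 0 < K + 1 by lra.
have := zK (`|z| / (K + 1)); rewrite divr_gt0// => /(_ isT).
rewrite mulrA ler_pdivlMr//; nra.
Qed.

(** * Meager ideals *)

Lemma nowhere_denseP (T : topologicalType) (F : set T) :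
  nowhere_dense F <->
  (forall U : set T, open U -> U !=set0 -> exists2 y, U y & nbhs y (~` F)).
Proof.
split=> [Fnd U oU [x Ux]|H].
  apply: contrapT => nex.
  suff : interior (closure F) x by rewrite Fnd.
  apply: (@filterS _ _ _ U); last exact: open_nbhs_nbhs.
  move=> y Uy B nB; apply: contrapT => FB0; apply: nex; exists y => //.
  by apply: filterS nB => z Bz Fz; apply: FB0; exists z.
rewrite /nowhere_dense -subset0 => x /= xi.
have [|y yi /= nFy] := H (interior (closure F)) (@open_interior _ _); first by exists x.
have /(_ _ nFy)[z [Fz nFz]] := interior_subset yi.
exact: nFz.
Qed.

(** Coordinatewise convergence is convergence in the product topology, a supremum of pulled-back
    topologies. Cylinders and boxes are shown to fit into neighborhoods by contradiction:
    counterexamples chosen ever closer to [f] would converge to it. *)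
Lemma ptws_nbhs_seq (U : eqType) (V : topologicalType)
    (f : prod_topology (fun _ : U => V)) (g : nat -> U -> V)
    (O : set (prod_topology (fun _ : U => V))) :
  nbhs f O -> (forall i, (fun n => g n i) @ \oo --> f i) ->
  exists n, O (g n).
Proof.
move=> nO gf.
have gcvg : (g : nat -> prod_topology (fun _ : U => V)) @ \oo --> f.
  apply/cvg_sup => i W [V'] [[W'] oW <-] WfN WU.
  apply: (filterS WU); rewrite nbhs_simpl /=.
  by apply: (gf i W'); apply: open_nbhs_nbhs.
have [n _ nP] := gcvg _ nO.
by exists n; apply: nP => /=.
Qed.

Lemma ptws_box_open (U : eqType) (V : topologicalType) (l : seq U) (O : U -> set V) :
  (forall i, open (O i)) ->
  open ([set g | forall i, i \in l -> O i (g i)] : set (prod_topology (fun _ : U => V))).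
Proof.
move=> oO; elim: l => [|i l IH].
  by rewrite (_ : [set _ | _] = setT); [exact: openT|apply/seteqP; split].
rewrite (_ : [set _ | _] = @proj U (fun=> V) i @^-1` O i `&`
    [set g : prod_topology (fun _ : U => V) | forall i, i \in l -> O i (g i)]).
  apply: openI IH; apply: open_comp => // g _.
  exact: (@proj_continuous U (fun=> V)).
apply/seteqP; split=> g /=.
  by move=> H; split=> [|j jl]; apply: H; rewrite inE ?eqxx// jl orbT.
by move=> [H1 H2] j; rewrite inE => /predU1P[->|/H2].
Qed.

Definition cylinder (s : seq bool) : set cantor_space :=
  [set B | forall i, (i < size s)%N -> B i = nth false s i].

Lemma cylinder_open (s : seq bool) : open (cylinder s).
Proof.
have := @ptws_box_open nat bool (iota 0 (size s))
  (fun i => [set nth false s i]) (fun=> @discrete_open bool _).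
by congr open; apply/seteqP; split=> B BP i; have := BP i; rewrite /= mem_iota.
Qed.

Lemma cylinder_nbhs (B : cantor_space) (O : set cantor_space) :
  nbhs B O -> exists n, cylinder (mkseq B n) `<=` O.
Proof.
move=> nO; apply: contrapT => /forallNP H.
have /choice[g gP] n : exists z, cylinder (mkseq B n) z /\ ~ O z.
  by have /existsNP[z /not_implyP zP] := H n; exists z.
have [|n] := @ptws_nbhs_seq nat bool B g O nO; last by case: (gP n).
move=> i W /nbhs_singleton WB; exists i.+1 => //= n /= lin.
have [/(_ i)] := gP n; rewrite size_mkseq => /(_ lin) -> _.
by rewrite nth_mkseq.
Qed.

Lemma cylinder_cat (s t : seq bool) : cylinder (s ++ t) `<=` cylinder s.
Proof.
move=> B BP i lis; rewrite BP ?nth_cat ?lis//.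
by rewrite size_cat ltn_addr.
Qed.

Lemma nowhere_dense_extension (F : set cantor_space) (s : seq bool) :
  nowhere_dense F -> exists t, cylinder (s ++ t) `<=` ~` F.
Proof.
move=> /nowhere_denseP /(_ _ (cylinder_open s)) [|B sB nB].
  by exists (nth false s).
have [n nF] := cylinder_nbhs _ _ nB.
exists (mkseq (fun i => B (size s + i)%N) n) => C CP; apply: nF => i.
rewrite size_mkseq => lin; rewrite CP; last by rewrite size_cat size_mkseq ltn_addl.
rewrite nth_cat; case: ltnP => lis; first by rewrite nth_mkseq// sB.
rewrite !nth_mkseq//; last lia.
by rewrite subnKC.
Qed.

(** Extend for one pair after another: a set once avoided stays avoided, since cylinders shrink
    under further extension. *)
Lemma nowhere_dense_common_extension (F : nat -> set cantor_space)
    (l : seq (seq bool * nat)) :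
  (forall n, nowhere_dense (F n)) ->
  exists t, forall s i, (s, i) \in l -> cylinder (s ++ t) `<=` ~` F i.
Proof.
move=> Fnd; elim: l => [|[s i] l [t tP]]; first by exists [::].
have [t' t'P] := nowhere_dense_extension _ (s ++ t) (Fnd i).
exists (t ++ t') => s' i'; rewrite inE catA => /predU1P[[-> ->]//|/tP].
by apply: subset_trans; apply: cylinder_cat.
Qed.

(** The [j]-th interval has room for a pattern that, after any prefix of length [m j], forces a set
    out of [F 0], ..., [F j]. If [A] were in [I], so would be its subset [B] that carries the
    patterns on the intervals inside [A] and is empty elsewhere; but the patterns exclude [B] from
    every [F i]. *)
Lemma meager_ideal_intervals (I : set (set nat)) :
  is_ideal I -> meager_ideal I ->
  exists m : nat -> nat, (forall j, m j < m j.+1)%N /\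
    forall A : set nat,
      (forall N, exists2 j, (N <= j)%N &
         forall i, (m j <= i < m j.+1)%N -> A i) -> ~ I A.
Proof.
move=> [_ Isub _ _] [F [Fnd IF]].
pose l n j := [seq (val t, i) | t <- enum {: n.-tuple bool}, i <- iota 0 j.+1].
have /choice[r rP] (nj : nat * nat) :
    exists t, forall s i, size s = nj.1 -> (i <= nj.2)%N ->
      cylinder (s ++ t) `<=` ~` F i.
  have [t tP] := nowhere_dense_common_extension F (l nj.1 nj.2) Fnd.
  exists t => s i /eqP ss ij; apply: tP.
  apply/allpairsP; exists (Tuple ss, i).
  by split; rewrite ?mem_enum ?mem_iota.
(* The extra 1 keeps the intervals nonempty when the pattern is empty. *)
pose m := fix m j := if j is j'.+1 then (m j' + size (r (m j', j')) + 1)%N else 0%N.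
have mS j : m j.+1 = (m j + size (r (m j, j)) + 1)%N by [].
have mlt j : (m j < m j.+1)%N by rewrite mS; lia.
have mmono : {homo m : i j / (i <= j)%N}.
  by apply: homo_leq => [//|i j k|j]; [exact: leq_trans|exact: ltnW].
exists m; split=> // A Ainf IA.
pose J j := forall i, (m j <= i < m j.+1)%N -> A i.
pose B : set nat := [set i | exists j, [/\ J j, (m j <= i < m j.+1)%N
  & nth false (r (m j, j)) (i - m j)]].
have BA : B `<=` A by move=> i [j [Jj ij _]]; exact: Jj.
have [i _ FiB] : (\bigcup_n F n) (indicator_of B).
  by apply: IF; exists B => //; exact: Isub IA.
have [j ij Jj] := Ainf i.
apply: (rP (m j, j) (mkseq (indicator_of B) (m j)) i _ ij _ _ FiB).
  by rewrite size_mkseq.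
move=> k; rewrite size_cat size_mkseq nth_cat size_mkseq => lk /=.
case: ltnP => ljk; first by rewrite nth_mkseq.
(* The intervals are disjoint, so the bit of [B] at this position can only come from the [j]-th
   pattern. *)
rewrite /indicator_of; apply/idP/idP => [/asboolP[j' [_ j'k]]|kr].
  suff -> : j' = j by [].
  apply/eqP; rewrite eqn_leq; apply/andP; split; rewrite leqNgt; apply/negP.
    by move=> /mmono jj'; have := mS j; lia.
  by move=> /mmono jj'; move: j'k; lia.
by apply/asboolP; exists j; split=> //; rewrite mS; lia.
Qed.

(** * Word frequencies and circulations *)

Fixpoint occurrences (T : eqType) (s w : seq T) : nat :=
  if w is _ :: w' then (prefix s w + occurrences T s w')%N else 0%N.
Arguments occurrences {T}.

Lemma occurrences_cons (T : eqType) (s w : seq T) a :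
  occurrences s (a :: w) = (prefix s (a :: w) + occurrences s w)%N.
Proof. by []. Qed.

Lemma occurrencesE (T : eqType) (s w : seq T) :
  occurrences s w = count (fun i => prefix s (drop i w)) (iota 0 (size w)).
Proof.
elim: w => [|a w IH]; first by [].
set P := fun i => _; rewrite occurrences_cons IH.
by rewrite -[RHS]/(P 0 + count P (iota (1 + 0) (size w)))%N iotaDl count_map.
Qed.

Lemma leq_occurrences_size (T : eqType) (s w : seq T) :
  (occurrences s w <= size w)%N.
Proof. by rewrite occurrencesE -[leqRHS](size_iota 0) count_size. Qed.

Lemma occurrences_map (T U : eqType) (f : T -> U) (s w : seq T) :
  injective f -> occurrences (map f s) (map f w) = occurrences s w.
Proof.
move=> f_inj; rewrite !occurrencesE size_map; apply: eq_count => i.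
by rewrite !prefixE size_map -map_drop -map_take (inj_eq (inj_map f_inj)).
Qed.

Lemma prefix_cat_small (T : eqType) (s u v : seq T) :
  (size s <= size u)%N -> prefix s (u ++ v) = prefix s u.
Proof. by move=> su; rewrite !prefixE takel_cat. Qed.

Lemma occurrences_cat_ge (T : eqType) (s u v : seq T) :
  (occurrences s u + occurrences s v <= occurrences s (u ++ v))%N.
Proof.
elim: u => [|a u IH]; first by [].
rewrite cat_cons !occurrences_cons -addnA leq_add//.
case: (boolP (prefix s (a :: u))) => // su.
by rewrite -cat_cons (prefix_trans su)// prefix_prefix.
Qed.

(** A new occurrence straddles the junction, so it starts among the last [size s] letters of [u].
    The induction uses the sharper error [minn (size u) (size s)], which grows only while [u] is
    shorter than [s]. *)
Lemma occurrences_cat_le (T : eqType) (s u v : seq T) :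
  (occurrences s (u ++ v) <= occurrences s u + occurrences s v + size s)%N.
Proof.
suff : (occurrences s (u ++ v) <=
  occurrences s u + occurrences s v + minn (size u) (size s))%N by lia.
elim: u => [|a u IH]; first by rewrite min0n addn0.
rewrite cat_cons !occurrences_cons -cat_cons.
have [su|us] := leqP (size s) (size (a :: u)).
  by rewrite prefix_cat_small//; move: su IH => /=; lia.
by move: us IH (leq_b1 (prefix s ((a :: u) ++ v)));
  rewrite -[size (a :: u)]/(size u).+1; lia.
Qed.

(** Pigeonhole: two of the first [#|U|.+1] iterates coincide. *)
Lemma periodic_iterate (U : finType) (f : U -> U) (x : U) :
  exists m n : nat, (0 < n)%N /\ iter n f (iter m f x) = iter m f x.
Proof.
have : ~~ uniq (traject f x #|U|.+1).
  apply/negP => /card_uniqP; rewrite size_traject => E.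
  by have := max_card (mem (traject f x #|U|.+1)); rewrite E ltnn.
move=> /(uniqPn x)[i [j [ij]]]; rewrite size_traject => jU.
rewrite !nth_traject//; last exact: ltn_trans jU.
move=> E; exists i, (j - i)%N; split; first by rewrite subn_gt0.
by rewrite -iterD subnK// ltnW.
Qed.

Section circulations.
Context {R : realType} {T : finType} (k : nat).
Implicit Types (p q : k.+1.-tuple T -> R).

(** The scale is a free parameter [M] rather than the length of [w]: the total mass of [p] is
    arbitrary here, and a common [M] lets sums be treated by concatenation. *)
Definition approximable p := forall eps : R, 0 < eps ->
  exists M0 : nat, forall M : nat, (M0 <= M)%N -> exists w : seq T,
    forall s : k.+1.-tuple T, `|(occurrences s w)%:R - M%:R * p s| <= eps * M%:R.

(** Kirchhoff's law on the de Bruijn graph: vertices are the [k]-tuples, edges the [k.+1]-tuples;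
    [a :: s] enters the vertex [s] and [rcons s a] leaves it. *)
Definition circulation p := forall s : k.-tuple T,
  \sum_(a : T) p [tuple of a :: s] = \sum_(a : T) p [tuple of rcons s a].

Lemma approximable_ext p q : p =1 q -> approximable p -> approximable q.
Proof. by move=> pq; rewrite (_ : p = q)//; apply/funext. Qed.

Lemma approximable0 : approximable (fun=> 0).
Proof.
move=> eps eps0; exists 0%N => M _; exists [::] => s /=.
by rewrite mulr0 subr0 normr0 mulr_ge0// ltW.
Qed.

(** Concatenate the two words. Each costs a third of [eps]; the last third pays for the at most
    [k.+1] occurrences across the junction. *)
Lemma approximableD p q :
  approximable p -> approximable q -> approximable (fun s => p s + q s).
Proof.
move=> ap aq eps eps0.
have e3 : 0 < eps / 3%:R by rewrite divr_gt0.
have [M1 H1] := ap _ e3; have [M2 H2] := aq _ e3.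
have [M3 H3] := large_nat k.+1%:R _ e3.
exists (maxn M1 (maxn M2 M3)) => M; rewrite !geq_max => /and3P[/H1[u uP] /H2[v vP] /H3 M3P].
exists (u ++ v) => s; have := occurrences_cat_ge T s u v.
have := occurrences_cat_le T s u v; rewrite size_tuple.
move=> le1 le2; have := uP s; have := vP s.
move: le1 le2; rewrite -!(ler_nat R) !natrD.
move=> le1 le2.
rewrite !ler_norml => /andP[? ?] /andP[? ?]; apply/andP; split; lra.
Qed.

Section cycle.
Variable f : k.+1.-tuple T -> k.+1.-tuple T.
Hypothesis f_shift : forall e, exists a, f e = [tuple of rcons (behead e) a].

(** An orbit of [f] is a walk along consecutive edges. Each step moves the letters one place
    forward, so the first letters along the orbit spell the edges visited. *)
Lemma nth_shift (x0 : T) j (e : k.+1.-tuple T) : (j <= k)%N -> nth x0 e j = thead (iter j f e).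
Proof.
elim: j e => [|j IH] e jk; first by rewrite (tuple_eta e).
rewrite iterSr -IH 1?ltnW//; have [a ->] := f_shift e.
by rewrite /= nth_rcons size_behead size_tuple /= jk nth_behead.
Qed.

Lemma take_trajectory e N : (k < N)%N ->
  take k.+1 [seq thead i | i <- traject f e N] = e.
Proof.
move=> kN; apply: (@eq_from_nth _ (thead e)).
  by rewrite size_takel ?size_tuple ?size_map ?size_traject.
move=> i; rewrite size_takel ?size_map ?size_traject// => ik.
by rewrite nth_take// (nth_map e) ?size_traject ?nth_traject ?nth_shift//; lia.
Qed.

(** By [take_trajectory] each position of the spelled word starts with the edge visited there,
    except near the end, where fewer than [k.+1] letters remain. *)
Lemma occurrences_trajectory (s : k.+1.-tuple T) e N :
  (occurrences s [seq thead i | i <- traject f e N] <= count_mem s (traject f e N)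
   <= occurrences s [seq thead i | i <- traject f e N] + k.+1)%N.
Proof.
suff : (occurrences s [seq thead i | i <- traject f e N]
   <= count_mem s (traject f e N)
   <= occurrences s [seq thead i | i <- traject f e N] + minn N k.+1)%N by lia.
elim: N e => // N IH e.
have := IH (f e); rewrite trajectS map_cons occurrences_cons.
rewrite -[count_mem _ (_ :: _)]/((e == s) + count_mem s (traject f (f e) N))%N.
rewrite -[thead e :: _]/([seq thead i | i <- traject f e N.+1]) prefixE size_tuple.
have [kN|Nk] := leqP k.+1 N.+1; first by rewrite take_trajectory// -val_eqE/=; lia.
rewrite (_ : (_ == tval s) = false); first by case: (e == s); lia.
apply/eqP => /(congr1 size); rewrite size_tuple take_oversize size_map size_traject; lia.
Qed.

Lemma count_mem_trajectory (s x : k.+1.-tuple T) n r : iter n f x = x ->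
  count_mem s (traject f x (r * n)) = (r * count_mem s (traject f x n))%N.
Proof.
move=> fx; elim: r => //= r IH.
by rewrite !mulSn trajectD count_cat fx IH.
Qed.

(** Run through the cycle [l * M] times, rounded down: rounding costs at most [n] occurrences and
    the end of the word at most [k.+1]. *)
Lemma approximable_cycle (x : k.+1.-tuple T) n (l : R) : iter n f x = x -> 0 <= l ->
  approximable (fun s => l * (count_mem s (traject f x n))%:R).
Proof.
move=> fx l0 eps eps0.
have [M0 M0P] := large_nat (k.+1 + n)%:R _ eps0.
exists M0 => M /M0P M0M.
set r := Num.truncn (l * M%:R).
have /truncn_itv : 0 <= l * M%:R by rewrite mulr_ge0.
rewrite -/r => /andP[rle rgt].
exists [seq thead i | i <- traject f x (r * n)] => s.
have := occurrences_trajectory s x (r * n); rewrite count_mem_trajectory//.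
have : (count_mem s (traject f x n) <= n)%N.
  by rewrite -[leqRHS](size_traject f x n) count_size.
move: rgt M0M; rewrite -natr1 natrD.
move: (count_mem _ _) (occurrences _ _) => c o.
rewrite -!(ler_nat R) !natrD natrM => rgt nm cn /andP[le1 le2].
have h1 : (l * M%:R - r%:R) * c%:R <= 1 * n%:R by apply: ler_pM => //; lra.
have h2 : 0 <= (l * M%:R - r%:R) * c%:R by apply: mulr_ge0 => //; lra.
have h3 : 0 <= k.+1%:R :> R by [].
rewrite (_ : M%:R * (l * c%:R) = l * M%:R * c%:R); last by ring.
rewrite ler_norml; apply/andP; split; lra.
Qed.

(** If an edge [e] enters [s], then [f e] leaves [s], and conversely ([step]). Around a closed orbit
    arrivals and departures therefore balance. *)
Lemma circulation_cycle (x : k.+1.-tuple T) n (l : R) : iter n f x = x ->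
  circulation (fun s => l * (count_mem s (traject f x n))%:R).
Proof.
move=> fx s; rewrite -!mulr_sumr; congr (_ * _).
rewrite -!natr_sum; congr (_%:R).
under eq_bigr do rewrite -sum1_count big_mkcond/=.
under [RHS]eq_bigr do rewrite -sum1_count big_mkcond/=.
rewrite exchange_big [RHS]exchange_big/=.
have to_iter (G : k.+1.-tuple T -> nat) m :
  (\sum_(e <- traject f x m) G e = \sum_(0 <= i < m) G (iter i f x))%N.
  by rewrite (big_nth x) size_traject; apply: eq_big_nat => i /andP[_ im]; rewrite nth_traject.
rewrite !to_iter.
case: n fx => [|n] fx; first by rewrite !big_geq.
(* Departures lag arrivals by one index; the two end terms are matched by [fx], which closes the
   orbit. *)
rewrite [RHS]big_nat_recl// [LHS]big_nat_recr//= -{3}fx addnC.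
have step e : (\sum_(a : T) (if e == [tuple of a :: s] then 1 else 0) =
    \sum_(a : T) (if f e == [tuple of rcons s a] then 1 else 0))%N.
  have [a ->] := f_shift e.
  have E1 : (\sum_(c : T) (if e == [tuple of c :: s] then 1 else 0) =
      (behead e == s :> seq T))%N.
    rewrite (bigD1 (thead e))//= big1 ?addn0 => [|c /negPf ce].
      by rewrite {1}(tuple_eta e) -val_eqE/= eqseq_cons eqxx/=; case: eqP.
    by rewrite {1}(tuple_eta e) -val_eqE/= eqseq_cons eq_sym ce.
  have E2 : (\sum_(c : T)
      (if [tuple of rcons (behead e) a] == [tuple of rcons s c] then 1 else 0) =
      (behead e == s :> seq T))%N.
    rewrite (bigD1 a)//= big1 ?addn0 => [|c /negPf ca].
      by rewrite -val_eqE/= eqseq_rcons eqxx andbT; case: eqP.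
    by rewrite -val_eqE/= eqseq_rcons (eq_sym a) ca andbF.
  by rewrite E1 -E2.
rewrite step -iterS; congr (_ + _)%N.
by apply: eq_big_nat => i _; rewrite step -iterS.
Qed.

End cycle.

Lemma circulation_next p : (forall e, 0 <= p e) -> circulation p ->
  forall e : k.+1.-tuple T, 0 < p e ->
  exists a, 0 < p [tuple of rcons (behead e) a].
Proof.
move=> p0 pc e pe.
have : 0 < \sum_(a : T) p [tuple of rcons (behead_tuple e) a].
  rewrite -pc (bigD1 (thead e))//= ltr_wpDr ?sumr_ge0//.
  by move: pe; rewrite {1}(tuple_eta e).
apply: contraPP => /forallNP H; apply/negP; rewrite -leNgt.
by apply: sumr_le0 => a _; rewrite leNgt; exact/negP/H.
Qed.

Lemma circulationB p q : circulation p -> circulation q ->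
  circulation (fun s => p s - q s).
Proof. by move=> cp cq s; rewrite !sumrB cp cq. Qed.

(* A nonzero circulation carries a cycle in its support; subtracting as large a
   multiple of it as possible makes the support smaller. *)
Lemma circulation_approximable p :
  (forall e, 0 <= p e) -> circulation p -> approximable p.
Proof.
have [n] := ubnP #|[set e | p e != 0]%SET|; elim: n p => // n IH p pn p0 pc.
have [/existsP[e0 pe0]|/existsPn pz] := boolP [exists e, p e != 0]; last first.
  by apply: approximable_ext approximable0 => e; have := pz e; rewrite negbK => /eqP.
have {}pe0 : 0 < p e0 by rewrite lt0r pe0 p0.
(* [f] follows edges of positive weight; off the support any successor does, which makes [f]
   total. *)
have /choice[f fP] (e : k.+1.-tuple T) : exists e',
    (exists a, e' = [tuple of rcons (behead e) a]) /\ (0 < p e -> 0 < p e').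
  have [pe|pe] := ltP 0 (p e); last first.
    by exists [tuple of rcons (behead e) (thead e)]; split => //; exists (thead e).
  have [a pa] := circulation_next p p0 pc e pe.
  by exists [tuple of rcons (behead e) a]; split => //; exists a.
have fs e : exists a, f e = [tuple of rcons (behead e) a] by case: (fP e).
have fpos i : 0 < p (iter i f e0) by elim: i => //= i; case: (fP (iter i f e0)) => _; apply.
have [m [r [r0 fr]]] := periodic_iterate _ f e0.
set x := iter m f e0 in fr.
pose c s : nat := count_mem s (traject f x r).
have cpos s : (0 < c s)%N -> 0 < p s.
  rewrite -has_count has_pred1 => /trajectP[i _ ->].
  by rewrite -iterD.
have cx : (0 < c x)%N.
  by rewrite /c; case: (r) r0 => // r' _; rewrite /= eqxx.
(* The minimal ratio is the largest multiple of the cycle that can be removed while keeping [q]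
   nonnegative; [q] then vanishes at [s]. *)
have := @arg_minP _ R _ x (fun s => 0 < c s)%N (fun s => p s / (c s)%:R) cx.
case=> s cs smin; set l := p s / (c s)%:R in smin.
have l0 : 0 <= l by rewrite divr_ge0.
pose q s := p s - l * (c s)%:R.
apply: (@approximable_ext (fun s => q s + l * (c s)%:R)) => [e|].
  by rewrite subrK.
apply: approximableD; last exact: approximable_cycle.
apply: IH.
- rewrite -ltnS; apply: leq_trans pn; rewrite ltnS; apply: proper_card.
  apply/fintype.properP; split.
    apply/fintype.subsetP => e; rewrite !inE /q; apply: contra_neq => pe.
    have [/cpos|] := boolP (0 < c e)%N; first by rewrite pe ltxx.
    by rewrite -eqn0Ngt pe => /eqP ->; rewrite mulr0 subr0.
  exists s; rewrite !inE; first by rewrite gt_eqF// cpos.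
  by rewrite negbK /q /l divfK ?subrr// pnatr_eq0 -lt0n.
- move=> e; rewrite subr_ge0.
  have [ce|] := boolP (0 < c e)%N; last by rewrite -eqn0Ngt => /eqP ->; rewrite mulr0.
  by rewrite -ler_pdivlMr ?ltr0n//; exact: smin.
- exact/circulationB/circulation_cycle.
Qed.

End circulations.

(** * Expansions in base [b] *)

Section expansions.
Context {R : realType} (b : nat).
Hypothesis b_gt1 : (1 < b)%N.
Implicit Types (x : R) (d : nat -> nat).

(** The integer with base-[b] digits [d 1], ..., [d n]; the value [d 0] is a dummy, as digits are
    numbered from 1. *)
Fixpoint digits_value d (n : nat) : nat :=
  if n is n'.+1 then (b * digits_value d n' + d n'.+1)%N else 0%N.

Lemma expn_bR_gt0 n : 0 < (b ^ n)%:R :> R.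
Proof. by rewrite ltr0n expn_gt0 (ltnW b_gt1). Qed.

Lemma large_expn (eps : R) : 0 < eps -> exists n, 1 < (b ^ n)%:R * eps.
Proof.
move=> eps0; have [n nP] := large_nat 1 _ eps0.
exists n; apply: (le_lt_trans (nP n (leqnn n))).
by rewrite mulrC ltr_pM2r// ltr_nat ltn_expl.
Qed.

Lemma digits_value_mono d n m : (forall i, (d i < b)%N) ->
  (digits_value d n * b ^ m <= digits_value d (n + m)
   < (digits_value d n).+1 * b ^ m)%N.
Proof.
move=> db; elim: m => [|m IH]; first by rewrite addn0 expn0 !muln1 leqnn ltnS leqnn.
by rewrite addnS expnS /=; have := db (n + m).+1; nia.
Qed.

Lemma digits_valueE d n :
  \sum_(1 <= i < n.+1) (d i)%:R / (b%:R ^+ i) = (digits_value d n)%:R / (b ^ n)%:R :> R.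
Proof.
elim: n => [|n IH]; first by rewrite big_geq// mul0r.
rewrite big_nat_recr//= IH !natrX natrD natrM exprS mulrDl; congr (_ + _).
have b0 : b%:R != 0 :> R by rewrite pnatr_eq0; lia.
by field; rewrite expf_neq0.
Qed.

(** The lower bound is strict because some digit after the [n]-th is nonzero; a tail of digits
    [b - 1] gives equality on the right. *)
Lemma expansion_bounds x d n : is_nonterm_expansion b x d ->
  (digits_value d n)%:R < (b ^ n)%:R * x <= (digits_value d n).+1%:R.
Proof.
move=> [db dx dnt].
have dx' : (fun N => (digits_value d N)%:R / (b ^ N)%:R : R) @ \oo --> x.
  by move: dx; rewrite -cvg_shiftS; under eq_fun do rewrite digits_valueE.
apply/andP; split.
  have [m nm dm] := dnt n.+1.
  have [m' E] : exists m', m = (n + m').+1 by exists (m - n.+1)%N; lia.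
  have lt_m : (digits_value d n * b ^ m'.+1 < digits_value d m)%N.
    rewrite E /= expnS; have /andP[le_m _] := digits_value_mono d n m' db.
    by rewrite -E; nia.
  have le_x : (digits_value d m)%:R / (b ^ m)%:R <= x.
    apply: (cvgr_to_ge dx'); exists m => // N /= mN.
    rewrite ler_pdivrMr ?expn_bR_gt0// mulrAC ler_pdivlMr ?expn_bR_gt0//.
    rewrite -!natrM ler_nat; have /andP[] := digits_value_mono d m (N - m) db.
    have -> : (b ^ N = b ^ m * b ^ (N - m))%N by rewrite -expnD subnKC.
    by rewrite subnKC// => le_N _; rewrite mulnCA [leqRHS]mulnC leq_mul2l le_N orbT.
  rewrite mulrC -ltr_pdivrMr ?expn_bR_gt0//; apply: lt_le_trans le_x.
  rewrite ltr_pdivrMr ?expn_bR_gt0// mulrAC ltr_pdivlMr ?expn_bR_gt0//.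
  rewrite -!natrM ltr_nat {1}E -addnS expnD.
  by have : (0 < b ^ n)%N by [rewrite expn_gt0 (ltnW b_gt1)]; nia.
rewrite mulrC -ler_pdivlMr ?expn_bR_gt0//.
apply: (cvgr_to_le dx'); exists n => // N /= nN.
rewrite ler_pdivrMr ?expn_bR_gt0// mulrAC ler_pdivlMr ?expn_bR_gt0//.
rewrite -!natrM ler_nat; have /andP[_] := digits_value_mono d n (N - n) db.
have -> : (b ^ N = b ^ n * b ^ (N - n))%N by rewrite -expnD subnKC.
by rewrite subnKC// => lt_N; rewrite [leqRHS]mulnCA [leqLHS]mulnC leq_mul2l (ltnW lt_N) orbT.
Qed.

Lemma nat_bounds_unique (u v : nat) (y : R) :
  u%:R < y <= u.+1%:R -> v%:R < y <= v.+1%:R -> u = v.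
Proof.
move=> /andP[uy yu] /andP[vy yv]; apply/eqP; rewrite eqn_leq; apply/andP; split.
  by rewrite -ltnS -(ltr_nat R) (lt_le_trans uy).
by rewrite -ltnS -(ltr_nat R) (lt_le_trans vy).
Qed.

Lemma nat_bounds_exists (y : R) : 0 < y -> exists u : nat, u%:R < y <= u.+1%:R.
Proof.
move=> y0; have /truncn_itv/andP[le_y y_lt] := ltW y0.
case: (ltgtP (Num.truncn y)%:R y) le_y => // [lt_y _|E _].
  by exists (Num.truncn y); rewrite lt_y ltW.
move: E; case: (Num.truncn y) => [E|u <-]; first by rewrite -E ltxx in y0.
by exists u; rewrite ltr_nat ltnSn lexx.
Qed.

Lemma expansion_exists x : 0 < x <= 1 -> exists d, is_nonterm_expansion b x d.
Proof.
move=> /andP[x0 x1].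
(* [c n] is the ceiling of [b ^ n * x] minus one; the digits are the differences
   [c n.+1 - b * c n]. *)
have /choice[c cP] n : exists c : nat, c%:R < (b ^ n)%:R * x <= c.+1%:R.
  by apply: nat_bounds_exists; rewrite mulr_gt0// expn_bR_gt0.
have c0 : c 0%N = 0%N.
  by apply: nat_bounds_unique (cP 0%N) _; rewrite expn0 mul1r x0.
have b0 : 0 < b%:R :> R by rewrite ltr0n ltnW.
have cS n : (b * c n <= c n.+1 < b * (c n).+1)%N.
  have /andP[lo hi] := cP n; have /andP[loS hiS] := cP n.+1.
  move: loS hiS; rewrite expnS natrM -mulrA => loS hiS.
  apply/andP; split.
    by rewrite -ltnS -(ltr_nat R) natrM; apply: lt_le_trans hiS; rewrite ltr_pM2l.
  by rewrite -(ltr_nat R) natrM; apply: lt_le_trans loS _; rewrite ler_pM2l.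
pose d n := if n is m.+1 then (c n - b * c m)%N else 0%N.
have db i : (d i < b)%N by case: i => [|i] /=; [lia|have := cS i; lia].
have dc : digits_value d =1 c.
  by elim=> [|n IH]; [rewrite c0|rewrite /= IH subnKC//; case/andP: (cS n)].
have dist n : 0 < x - (c n)%:R / (b ^ n)%:R <= (b ^ n)%:R^-1.
  have /andP[lo hi] := cP n; have bn := expn_bR_gt0 n.
  rewrite subr_gt0 ltr_pdivrMr// mulrC lo/= lerBlDr -[X in _ <= X + _]mul1r -mulrDl.
  by rewrite ler_pdivlMr// mulrC nat1r.
exists d; split=> //.
  rewrite -cvg_shiftS; under eq_fun do rewrite digits_valueE dc.
  apply/cvgrPdist_lt => eps /large_expn[n0 n0P]; exists n0 => // n /= n0n.
  have /andP[lo hi] := dist n; rewrite gtr0_norm//.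
  apply: le_lt_trans hi _; rewrite -[_^-1]mul1r ltr_pdivrMr ?expn_bR_gt0//.
  have eps0 : 0 < eps by move: n0P; rewrite -(pmulr_rgt0 _ (expn_bR_gt0 n0)); lra.
  apply: lt_le_trans n0P _; rewrite mulrC ler_pM2l// ler_nat leq_exp2l//.
(* If all digits from [N] on vanished, [c (N + m) / b ^ (N + m)] would be constant in [m], so the
   positive distance from it to [x] would be at most [b ^ - (N + m)] for every [m]. *)
move=> N; apply: contrapT => nex.
have dN n : (N <= n)%N -> d n = 0%N.
  by move=> Nn; apply: contrapT => dn; apply: nex; exists n.
have cN m : c (N + m)%N = (c N * b ^ m)%N.
  elim: m => [|m IH]; first by rewrite addn0 expn0 muln1.
  have := dN (N + m).+1 (leq_trans (leq_addr _ _) (leqnSn _)).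
  by rewrite /= addnS expnS; have := cS (N + m)%N; rewrite IH; lia.
have /andP[/large_expn[m mP] _] := dist N.
have /andP[_] := dist (N + m)%N.
rewrite cN expnD !natrM -mulf_div divff ?mulr1 ?gt_eqF ?expn_bR_gt0//.
rewrite leNgt => /negP; apply; rewrite -[X in X < _]mul1r ltr_pdivrMr ?mulr_gt0 ?expn_bR_gt0//.
apply: lt_le_trans mP _; rewrite mulrC ler_pM2l.
  by rewrite -natrM ler_nat leq_pmull// expn_gt0 (ltnW b_gt1).
by have /andP[] := dist N.
Qed.

Lemma digits_expansion x : 0 < x <= 1 -> is_nonterm_expansion b x (digits b x).
Proof. by move=> /expansion_exists; exact: epsilon_spec. Qed.

Lemma digit_ltn x n : 0 < x <= 1 -> (digit b n x < b)%N.
Proof. by move=> /digits_expansion[db _ _]; exact: db. Qed.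

Lemma digits_value_inj d1 d2 n : (forall i, (d1 i < b)%N) -> (forall i, (d2 i < b)%N) ->
  digits_value d1 n = digits_value d2 n ->
  forall i, (0 < i <= n)%N -> d1 i = d2 i.
Proof.
move=> d1b d2b; elim: n => [|n IH] /= E i; first lia.
have vE : digits_value d1 n = digits_value d2 n.
  by have := d1b n.+1; have := d2b n.+1; nia.
have /addnI E' : (b * digits_value d2 n + d1 n.+1 = b * digits_value d2 n + d2 n.+1)%N.
  by rewrite -{1}vE.
case/andP=> i0; rewrite leq_eqVlt ltnS => /predU1P[->//|i_n]; apply: IH => //.
by rewrite i0.
Qed.

Lemma digits_value_lt d n : (forall i, (d i < b)%N) -> (digits_value d n < b ^ n)%N.
Proof. by move=> db; have := digits_value_mono d 0 n db; rewrite add0n mul1n => /andP[]. Qed.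

Lemma cylinder_unit x d n : (forall i, (d i < b)%N) ->
  (digits_value d n)%:R < (b ^ n)%:R * x <= (digits_value d n).+1%:R -> 0 < x <= 1.
Proof.
move=> db /andP[lo hi]; have bn := expn_bR_gt0 n; apply/andP; split.
  by rewrite -(pmulr_rgt0 _ bn); apply: le_lt_trans lo.
by rewrite -(ler_pM2l bn) mulr1 (le_trans hi)// ler_nat digits_value_lt.
Qed.

Lemma cylinder_digits x d n : (forall i, (d i < b)%N) ->
  (digits_value d n)%:R < (b ^ n)%:R * x <= (digits_value d n).+1%:R ->
  forall i, (0 < i <= n)%N -> digit b i x = d i.
Proof.
move=> db bnd; have /digits_expansion dx := cylinder_unit x d n db bnd.
apply: digits_value_inj => //; first by case: dx.
exact: nat_bounds_unique (expansion_bounds _ _ n dx) bnd.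
Qed.

End expansions.

(** * Frequencies along periodic tails *)

Lemma mkseqD (T : Type) (y : nat -> T) m n :
  mkseq y (m + n) = mkseq y m ++ mkseq (fun i => y (m + i)%N) n.
Proof.
rewrite /mkseq iotaD map_cat add0n; congr (_ ++ _).
by rewrite -{1}[m]addn0 iotaDl -map_comp.
Qed.

(** Each of the [q] full copies of [w] adds its own occurrences and at most [size s] across a
    junction; the free prefix and the partial copy add at most their lengths, up to one more
    junction. *)
Lemma occurrences_periodic (T : eqType) (x0 : T) (s w : seq T) (y : nat -> T)
    (n0 q r : nat) :
  (r <= size w)%N -> (forall i, y (n0 + i)%N = nth x0 w (i %% size w)) ->
  (q * occurrences s w <= occurrences s (mkseq y (n0 + q * size w + r))
   <= n0 + q * (occurrences s w + size s) + size s + r)%N.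
Proof.
move=> rw yw.
have block i m : (m <= size w)%N ->
    mkseq (fun j => y (n0 + i * size w + j)%N) m = take m w.
  move=> mw; apply: (@eq_from_nth _ x0); rewrite size_mkseq ?size_takel// => j jm.
  rewrite nth_mkseq// nth_take// -addnA yw modnMDl modn_small//.
  exact: leq_trans mw.
have full : (q * occurrences s w <= occurrences s (mkseq y (n0 + q * size w))
   <= n0 + q * (occurrences s w + size s))%N.
  elim: (q) => [|p IH].
    by rewrite !mul0n !addn0 leq0n (leq_trans (leq_occurrences_size _ _ _))// size_mkseq.
  rewrite [(p.+1 * size w)%N]mulSnr addnA mkseqD block// take_size.
  have := occurrences_cat_ge _ s (mkseq y (n0 + p * size w)) w.
  by have := occurrences_cat_le _ s (mkseq y (n0 + p * size w)) w; lia.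
rewrite mkseqD block//.
have := occurrences_cat_ge _ s (mkseq y (n0 + q * size w)) (take r w).
have := occurrences_cat_le _ s (mkseq y (n0 + q * size w)) (take r w).
by have := leq_occurrences_size _ s (take r w); rewrite size_takel//; lia.
Qed.

Section frequencies.
Context {R : realType} (b : nat).
Hypothesis b_gt1 : (1 < b)%N.

Definition letters (k : nat) (s : k.-tuple 'I_b) : seq nat := [seq val a | a <- s].

(** Blocks starting at positions up to [n] are read within the first [n + k] digits; the word's last
    [k] starting positions make the difference. Words are indexed from 0 and digits from 1, hence
    [e i.+1]. *)
Lemma count_occurs_at (k : nat) (s : k.-tuple 'I_b) (x : R) (e : nat -> nat) n :
  (forall i, (0 < i <= n + k)%N -> digit b i x = e i) ->
  (count (occurs_at b k x s) (iota 1 n)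
     <= occurrences (letters k s) (mkseq (fun i => e i.+1) (n + k))
     <= count (occurs_at b k x s) (iota 1 n) + k)%N.
Proof.
move=> xe; rewrite occurrencesE size_mkseq iotaD count_cat.
have -> : count (occurs_at b k x s) (iota 1 n) = count (fun i => prefix
    (letters k s) (drop i (mkseq (fun i => e i.+1) (n + k)))) (iota 0 n).
  rewrite -[1%N]/(1 + 0)%N iotaDl count_map; apply: eq_in_count => i.
  rewrite mem_iota/= => i_n; rewrite prefixE size_map size_tuple add1n.
  have sz : size (take k (drop i (mkseq (fun i => e i.+1) (n + k)))) = k.
    by rewrite size_takel// size_drop size_mkseq; lia.
  apply/forallP/eqP => [H|E j].
    apply: (@eq_from_nth _ 0%N); rewrite sz ?size_map ?size_tuple// => j jk.
    rewrite nth_take// nth_drop nth_mkseq; last lia.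
    have /eqP := H (Ordinal jk); rewrite xe/=; last lia.
    rewrite addSn => ->.
    rewrite (nth_map (tnth s (Ordinal jk))) ?size_tuple//.
    by congr val; exact: tnth_nth.
  have := congr1 (fun u => nth 0%N u j) E.
  rewrite nth_take// nth_drop nth_mkseq; last by have := ltn_ord j; lia.
  rewrite (nth_map (tnth s j)) ?size_tuple// -tnth_nth => <-.
  by rewrite xe//; have := ltn_ord j; lia.
rewrite leq_addr leq_add2l/= -[X in (_ <= X)%N](size_iota (0 + n) k).
exact: count_size.
Qed.

(* Each boundary between two copies of [w] creates at most [k] further
   occurrences of [s], whence the error [k / size w]. *)
Lemma freq_periodic (k : nat) (s : k.-tuple 'I_b) (x : R) (e : nat -> nat)
    (w : seq nat) (n0 n : nat) :
  (0 < size w)%N -> (n0 <= n)%N -> (0 < n)%N ->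
  (forall i, e (n0 + i).+1 = nth 0%N w (i %% size w)) ->
  (forall i, (0 < i <= n + k)%N -> digit b i x = e i) ->
  `|freq b k x s n - (occurrences (letters k s) w)%:R / (size w)%:R|
    <= k%:R / (size w)%:R + (n0 + size w + 2 * k + k * k)%:R / n%:R.
Proof.
move=> w0 n0n n_gt0 ew xe; have := count_occurs_at k s x e n xe.
set c := count _ _;
set q := ((n + k - n0) %/ size w)%N; set r := ((n + k - n0) %% size w)%N.
have rw : (r < size w)%N by rewrite ltn_mod.
have E : (n + k = n0 + q * size w + r)%N by rewrite -addnA -divn_eq; lia.
have := occurrences_periodic _ 0%N (letters k s) w (fun i => e i.+1) n0 q r (ltnW rw) ew.
rewrite -E size_map size_tuple; set o := occurrences _ (mkseq _ _).
have := leq_occurrences_size _ (letters k s) w; set ow := occurrences _ _.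
move: (size w) w0 rw E => L L0 rL E owL.
have L0' : 0 < L%:R :> R by rewrite ltr0n.
have n0' : 0 < n%:R :> R by rewrite ltr0n.
set t : R := ow%:R / L%:R; set u : R := k%:R / L%:R.
have owE : ow%:R = t * L%:R by rewrite divfK// gt_eqF.
have kE : k%:R = u * L%:R by rewrite divfK// gt_eqF.
have t0 : 0 <= t by rewrite divr_ge0.
have t1 : t <= 1 by rewrite ler_pdivrMr// mul1r ler_nat.
have u0 : 0 <= u by rewrite divr_ge0.
have uk : u <= k%:R by rewrite ler_pdivrMr// ler_peMr// ler1n.
move/(congr1 (fun i => i%:R : R)) : E; rewrite !natrD natrM => E.
rewrite mulnDr => /andP[] + + /andP[] + +.
rewrite -!(ler_nat R) !natrD => h1 h2 h3 h4.
have {}rL : r%:R <= L%:R :> R by rewrite ler_nat ltnW.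
have qw : (q * ow)%:R = q%:R * L%:R * t by rewrite natrM owE; ring.
have qk : (q * k)%:R = q%:R * L%:R * u by rewrite natrM kE; ring.
have qL : q%:R * L%:R = n%:R + k%:R - n0%:R - r%:R :> R by rewrite E; ring.
rewrite qw qL in h1 h2; rewrite qk qL in h2.
have [k0 n00 r0] : [/\ 0 <= k%:R :> R, 0 <= n0%:R :> R & 0 <= r%:R :> R] by [].
(* With these products bounded, the estimate multiplied by [n] becomes linear. *)
have a1 : 0 <= n0%:R * t <= n0%:R * 1 by rewrite mulr_ge0//= ler_wpM2l.
have a2 : 0 <= r%:R * t <= r%:R * 1 by rewrite mulr_ge0//= ler_wpM2l.
have a3 : 0 <= k%:R * t <= k%:R * 1 by rewrite mulr_ge0//= ler_wpM2l.
have a4 : 0 <= k%:R * u <= k%:R * k%:R by rewrite mulr_ge0//= ler_wpM2l.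
have a5 : 0 <= n0%:R * u by rewrite mulr_ge0.
have a6 : 0 <= r%:R * u by rewrite mulr_ge0.
have a7 : 0 <= n%:R * u by rewrite mulr_ge0.
rewrite /freq -/c -(ler_pM2r n0') -[X in _ * X <= _](gtr0_norm n0') -normrM.
rewrite !mulrDl mulNr !divfK ?gt_eqF// !natrM.
rewrite ler_norml; apply/andP; split; lra.
Qed.

(** Keep the first [n0] digits of the midpoint of [a] and [c], so as to stay between them, and
    continue with copies of [w]. The points sought are those sharing sufficiently many digits with
    this expansion. *)
Lemma frequency_interval (k : nat) (w : seq nat) (m : nat -> nat) (N : nat) (a c : R) :
  (0 < size w)%N -> all (fun i => i < b)%N w -> (forall j, m j < m j.+1)%N ->
  0 <= a -> a < c -> c <= 1 ->
  exists y, exists z, y < z /\ forall x, y < x < z -> a < x < c /\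
    exists2 j, (N <= j)%N & forall n, (m j <= n < m j.+1)%N ->
      forall s : k.-tuple 'I_b,
      `|freq b k x s n - (occurrences (letters k s) w)%:R / (size w)%:R|
        <= k%:R / (size w)%:R + N.+1%:R^-1.
Proof.
move=> w0 wb mS a0 ac c1.
pose x0 := (a + c) / 2%:R.
have x01 : 0 < x0 <= 1 by rewrite /x0; lra.
have [n0 n0P] : exists n0, 1 < (b ^ n0)%:R * ((c - a) / 2%:R).
  by apply: large_expn => //; rewrite divr_gt0// subr_gt0.
have db : forall i, (digit b i x0 < b)%N by move=> i; exact: digit_ltn.
pose e i := if (i <= n0)%N then digit b i x0 else nth 0%N w ((i - n0.+1) %% size w).
have eb i : (e i < b)%N.
  rewrite /e; case: ifP => // _; apply: (allP wb); apply: mem_nth.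
  by rewrite ltn_mod.
have ew i : e (n0 + i).+1 = nth 0%N w (i %% size w).
  by rewrite /e ltnNge leq_addr/= subSS addKn.
(* From time [C] on, the second error term of [freq_periodic] is at most [N.+1%:R^-1]. *)
pose C := ((n0 + size w + 2 * k + k * k) * N.+1)%N.
have mj j : (j <= m j)%N.
  by elim: j => // j IH; exact: leq_ltn_trans IH (mS j).
pose j := maxn N C.
(* Enough digits to read every block up to time [m j.+1], and at least the first [n0]. *)
pose P := (m j.+1 + k + n0)%N.
have bP := expn_bR_gt0 (R := R) b b_gt1 P.
exists ((digits_value b e P)%:R / (b ^ P)%:R), ((digits_value b e P).+1%:R / (b ^ P)%:R).
split; first by rewrite ltr_pM2r ?invr_gt0// ltr_nat.
move=> x; rewrite ltr_pdivrMr// ltr_pdivlMr// => /andP[lo hi].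
have xP : (digits_value b e P)%:R < (b ^ P)%:R * x <= (digits_value b e P).+1%:R.
  by rewrite mulrC lo ltW.
have x_unit := cylinder_unit b b_gt1 x e P eb xP.
have xe := cylinder_digits b b_gt1 x e P eb xP.
split.
  have E : digits_value b (digits b x) n0 = digits_value b (digits b x0) n0.
    have : forall i, (0 < i <= n0)%N -> digit b i x = digit b i x0.
      move=> i /andP[i0 i_n0]; rewrite xe /e ?i_n0//.
      by rewrite i0 /P (leq_trans i_n0)// leq_addl.
    rewrite /digit; elim: (n0) => //= n IH H.
    rewrite H ?leqnn// IH// => i /andP[i0 i_n]; apply: H.
    by rewrite i0 ltnW.
  have := expansion_bounds b b_gt1 _ _ n0 (digits_expansion b b_gt1 _ x01).
  have := expansion_bounds b b_gt1 _ _ n0 (digits_expansion b b_gt1 _ x_unit).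
  rewrite E -natr1 => /andP[h1 h2] /andP[h3 h4].
  have b0 := expn_bR_gt0 (R := R) b b_gt1 n0.
  by rewrite -(ltr_pM2l b0) -[X in _ && X](ltr_pM2l b0); move: h1 h2 h3 h4 n0P;
    rewrite /x0; lra.
exists j; first exact: leq_maxl.
move=> n /andP[jn nj] s.
have Cn : (C <= n)%N by rewrite (leq_trans _ jn)// (leq_trans _ (mj j))// leq_maxr.
have CC : (n0 + size w + 2 * k + k * k <= C)%N by rewrite leq_pmulr.
have n_gt0 : (0 < n)%N.
  by apply: leq_trans Cn; rewrite (leq_trans w0)// (leq_trans _ CC)// -!addnA addnCA leq_addr.
apply: le_trans (freq_periodic k s x e w n0 n w0 _ n_gt0 ew _) _.
    by apply: leq_trans Cn; apply: leq_trans CC; rewrite -!addnA leq_addr.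
  move=> i /andP[i0 i_nk]; apply: xe; rewrite i0 /P (leq_trans i_nk)//.
  by rewrite -addnA leq_add ?leq_addr// ltnW.
rewrite lerD2l ler_pdivrMr ?ltr0n// mulrC ler_pdivlMr ?ltr0n//.
by rewrite -natrM ler_nat.
Qed.

End frequencies.

(** * Cluster points *)

Lemma subspace_nowhere_dense (R : realType) (H : set R) :
  (forall a c : R, 0 <= a -> a < c -> c <= 1 ->
     exists y z, y < z /\ forall x, y < x < z -> a < x < c /\ H x) ->
  @nowhere_dense (@subspace (R : topologicalType) `]0, 1]%classic) (`]0, 1]%classic `\` H).
Proof.
move=> Hdense; apply/nowhere_denseP => U oU [x Ux].
have [Dx|nDx] := pselect (`]0, 1]%classic x); last first.
  by exists x => //; case: (@nbhs_subspaceP R `]0, 1]%classic x) => // _ _ -> [].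
have : nbhs x U by exact: open_nbhs_nbhs.
case: (@nbhs_subspaceP R `]0, 1]%classic x) => // _.
rewrite /within /= => -[eps /= eps0 epsU].
move: (Dx); rewrite /= in_itv/= => /andP[x0 x1].
(* Searching to the left of [x] also covers the endpoint 1. *)
have [||//|y [z [yz yzP]]] := Hdense (Num.max 0 (x - eps)) x.
- by rewrite le_max lexx.
- by rewrite gt_max x0 gtrBl.
have mid : y < (y + z) / 2%:R < z by rewrite midf_lt//= midf_lt.
have [/andP[+ mx] Hm] := yzP _ mid; rewrite gt_max => /andP[m0 mxe].
exists ((y + z) / 2%:R).
  apply: epsU; last by rewrite /= in_itv/= m0 (le_trans (ltW mx)).
  by rewrite /ball/= gtr0_norm; lra.
have Dm : `]0, 1]%classic ((y + z) / 2%:R) by rewrite /= in_itv/= m0 (le_trans (ltW mx)).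
case: (@nbhs_subspaceP R `]0, 1]%classic ((y + z) / 2%:R)) => // _.
have : nbhs ((y + z) / 2%:R) `]y, z[%classic.
  by apply: open_nbhs_nbhs; split; [exact: interval_open|rewrite /= in_itv].
apply: filterS => q /=; rewrite in_itv/= => /yzP[_ Hq] _ [_].
exact.
Qed.

Lemma ptws_nbhs_box (R : realType) (T : eqType) (p : prod_topology (fun _ : T => R))
    (U : set (prod_topology (fun _ : T => R))) : nbhs p U ->
  exists2 eps : R, 0 < eps & forall g, (forall s, `|g s - p s| <= eps) -> U g.
Proof.
move=> nU; apply: contrapT => nex.
have /choice[g gP] (n : nat) : exists g : T -> R,
    (forall s, `|g s - p s| <= n.+1%:R^-1) /\ ~ U g.
  apply: contrapT => /forallNP H; apply: nex; exists n.+1%:R^-1; first by rewrite invr_gt0.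
  by move=> g gp; apply: contrapT => nUg; exact: (H g).
have [|n] := ptws_nbhs_seq T R p g U nU; last by case: (gP n).
move=> s; apply/cvgrPdist_lt => eps eps0.
have [M0 M0P] := large_nat 1 _ eps0.
exists M0 => // n /= M0n; have [gs _] := gP n.
rewrite distrC (le_lt_trans (gs s))// -[X in X < _]mul1r ltr_pdivrMr//.
by apply: le_lt_trans (M0P _ M0n) _; rewrite ltr_pM2l// ltr_nat.
Qed.

Section cluster_points.
Context {R : realType} (b : nat).
Hypothesis b_gt1 : (1 < b)%N.

Lemma pseq_tuple (k : nat) (p : k.-tuple 'I_b -> R) (t : k.-tuple 'I_b) :
  pseq b k p t = p t.
Proof. by rewrite /pseq valK. Qed.

Section digit_strings.
Variable x : R.
Hypothesis x_unit : 0 < x <= 1.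

Definition digit_string (k i : nat) : k.-tuple 'I_b :=
  [tuple Ordinal (digit_ltn b b_gt1 x (i + j) x_unit) | j < k].

Lemma occurs_atE (k : nat) (s : k.-tuple 'I_b) i :
  occurs_at b k x s i = (s == digit_string k i).
Proof.
apply/forallP/eqP => [H|-> j]; last by rewrite tnth_mktuple.
by apply: eq_from_tnth => j; apply/val_inj; rewrite tnth_mktuple/= -(eqP (H j)).
Qed.

Lemma digit_string_cons k i : digit_string k.+1 i =
  [tuple of Ordinal (digit_ltn b b_gt1 x i x_unit) :: digit_string k i.+1].
Proof.
apply: eq_from_tnth => j; apply/val_inj; rewrite tnth_mktuple.
case: (unliftP ord0 j) => [j'|] ->; last by rewrite /= addn0.
by rewrite tnthS tnth_mktuple/= /bump leq0n add1n addnS.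
Qed.

Lemma digit_string_rcons k i : digit_string k.+1 i =
  [tuple of rcons (digit_string k i) (Ordinal (digit_ltn b b_gt1 x (i + k) x_unit))].
Proof.
elim: k i => [|k IH] i.
  rewrite digit_string_cons !(tuple0 (digit_string 0 _)); apply/val_inj => /=.
  by congr [:: _]; apply/val_inj; rewrite /= addn0.
rewrite digit_string_cons [in LHS]IH (digit_string_cons k i); apply/val_inj => /=.
by congr (_ :: rcons _ _); apply/val_inj; rewrite /= addSnnS.
Qed.

(** Exchanging the sums counts, at each position, the members of the family that occur there. This
    serves for the total mass and for both sides of the balance condition. *)
Lemma sum_freq_family (J : finType) (k n : nat) (F : J -> k.-tuple 'I_b)
    (G : nat -> bool) :
  (forall i, \sum_(a : J) (F a == digit_string k i : nat) = G i)%N ->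
  \sum_(a : J) freq b k x (F a) n = (count G (iota 1 n))%:R / n%:R.
Proof.
move=> FG; rewrite /freq -mulr_suml -natr_sum; congr (_%:R / _).
under eq_bigr do rewrite -sum1_count big_mkcond/=.
rewrite exchange_big/= -sum1_count [RHS]big_mkcond/=; apply: eq_bigr => i _.
by rewrite -[RHS]/(nat_of_bool (G i)) -FG; apply: eq_bigr => a _; rewrite occurs_atE; case: ifP.
Qed.

Lemma sum_freq (k n : nat) : (0 < n)%N -> \sum_(s : k.-tuple 'I_b) freq b k x s n = 1.
Proof.
move=> n0; rewrite (sum_freq_family _ _ _ id predT) => [|i].
  by rewrite count_predT size_iota divff// pnatr_eq0 -lt0n.
by rewrite (bigD1 (digit_string k i))//= eqxx big1 ?addn0// => s /negPf ->.
Qed.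

(** Both sums count occurrences of [s], starting at 2, ..., [n.+1] and at 1, ..., [n] respectively,
    so only the two extreme positions matter. *)
Lemma freq_balance (k n : nat) (s : k.-tuple 'I_b) :
  `|\sum_(a : 'I_b) freq b k.+1 x [tuple of a :: s] n -
    \sum_(a : 'I_b) freq b k.+1 x [tuple of rcons s a] n| <= n%:R^-1.
Proof.
rewrite (sum_freq_family _ _ _ _ (fun i => s == digit_string k i.+1)); last first.
  move=> i; rewrite (bigD1 (Ordinal (digit_ltn b b_gt1 x i x_unit)))//=.
  rewrite big1 ?addn0 => [|a /negPf na].
    by rewrite digit_string_cons -!val_eqE/= eqseq_cons eqxx.
  by rewrite digit_string_cons -val_eqE/= eqseq_cons na.
rewrite (sum_freq_family _ _ _ _ (fun i => s == digit_string k i)); last first.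
  move=> i; rewrite (bigD1 (Ordinal (digit_ltn b b_gt1 x (i + k) x_unit)))//=.
  rewrite big1 ?addn0 => [|a /negPf na].
    by rewrite digit_string_rcons -!val_eqE/= eqseq_rcons eqxx andbT.
  by rewrite digit_string_rcons -val_eqE/= eqseq_rcons na andbF.
have shift : ((s == digit_string k 1) +
      count (fun i => s == digit_string k i.+1) (iota 1 n) =
    count (fun i => s == digit_string k i) (iota 1 n) + (s == digit_string k n.+1))%N.
  transitivity (count (fun i => s == digit_string k i) (iota 1 n.+1)).
    by rewrite [in RHS]/= -[2%N]/(1 + 1)%N iotaDl count_map.
  by rewrite -[iota 1 n.+1]/(iota 1 (1 + n)) [(1 + n)%N]addnC iotaD count_cat/= addn0 add1n.
rewrite -mulrBl normrM (ger0_norm (_ : 0 <= n%:R^-1 :> R)) ?invr_ge0//.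
rewrite ler_piMl ?invr_ge0//; move: shift.
move=> /(congr1 (fun i => i%:R : R)); rewrite !natrD.
by case: (s == _); case: (s == _) => /= H; rewrite ler_norml; apply/andP; split; lra.
Qed.

End digit_strings.

Lemma Gamma_sub_Delta (k : nat) (x : R) (I : set (set nat)) : is_ideal I ->
  0 < x <= 1 -> Gamma b k.+1 x I `<=` Delta R b k.+1.
Proof.
move=> [_ Isub Ifin _] x_unit p /= pG.
(* Finite sets belong to [I], so a cluster point is approached at arbitrarily late times. *)
have near_p eps n0 : 0 < eps -> exists2 n, (n0 <= n)%N &
    forall s, `|freq b k.+1 x s n - p s| < eps.
  move=> eps0; apply: contrapT => nex.
  pose U : set (prod_topology (fun _ : k.+1.-tuple 'I_b => R)) :=
    [set g | forall s, s \in enum {: k.+1.-tuple 'I_b} -> ball (p s) eps (g s)].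
  refine (pG U _ _ _).
  - by apply: (@ptws_box_open _ R _ (fun s => ball (p s) eps)) => s; exact: ball_open.
  - by move=> s _; exact: ballxx.
  - apply: (Isub `I_n0); last exact/Ifin/finite_II.
    move=> n /= Un; rewrite ltnNge; apply/negP => n0n; apply: nex; exists n => // s.
    by have := Un s; rewrite mem_enum => /(_ isT); rewrite /ball/= distrC.
split.
- apply/eqP; rewrite -subr_eq0; apply/eqP.
  apply: (@eq0_small _ _ #|{: k.+1.-tuple 'I_b}|%:R) => // eps eps0.
  have [n n1 nP] := near_p eps 1%N eps0.
  rewrite -[X in `|_ - X|](sum_freq x x_unit k.+1 n)// -sumrB (le_trans (ler_norm_sum _ _ _))//.
  rewrite mulr_natl -sumr_const; apply: ler_sum => s _.
  by rewrite distrC ltW.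
- move=> s; rewrite leNgt; apply/negP => ps.
  have ps' : 0 < - p s by rewrite oppr_gt0.
  have [n _ /(_ s)] := near_p _ 0%N ps'.
  have : 0 <= freq b k.+1 x s n by rewrite divr_ge0.
  by move=> f0; rewrite ger0_norm; lra.
- move=> s; apply/eqP; rewrite -subr_eq0; apply/eqP.
  (* Two sums of [b] terms, each off by [eps], and the imbalance [n%:R^-1], at most [eps] for late
     [n]. *)
  apply: (@eq0_small _ _ (2 * b%:R + 1)); first by rewrite addr_ge0// mulr_ge0.
  move=> eps eps0; have [M0 M0P] := large_nat 1 _ eps0.
  have [n M0n nP] := near_p eps M0.+1 eps0.
  have inv_n : n%:R^-1 <= eps.
    rewrite -[leLHS]mul1r ler_pdivrMr ?ltr0n ?(leq_ltn_trans _ M0n)//.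
    by apply: M0P; exact: ltnW.
  have close (F : 'I_b -> k.+1.-tuple 'I_b) :
      `|\sum_a freq b k.+1 x (F a) n - \sum_a p (F a)| <= b%:R * eps.
    rewrite -sumrB (le_trans (ler_norm_sum _ _ _))//.
    rewrite -[b in b%:R]card_ord mulr_natl -sumr_const; apply: ler_sum => a _.
    exact: ltW.
  have E1 : \sum_a pseq b k.+1 p (a :: s) = \sum_a p [tuple of a :: s].
    by apply: eq_bigr => a _; rewrite -pseq_tuple.
  have E2 : \sum_a pseq b k.+1 p (rcons s a) = \sum_a p [tuple of rcons s a].
    by apply: eq_bigr => a _; rewrite -pseq_tuple.
  rewrite E1 E2.
  have := close (fun a => [tuple of a :: s]).
  have := close (fun a => [tuple of rcons s a]).
  have := freq_balance x x_unit k n s; move: inv_n.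
  rewrite !ler_norml => ? /andP[? ?] /andP[? ?] /andP[? ?]; apply/andP; split; lra.
Qed.

End cluster_points.

(** * Words with prescribed frequencies *)

Lemma sum_occurrences (T : finType) (k : nat) (w : seq T) :
  (\sum_(s : k.+1.-tuple T) occurrences s w <= size w
   <= \sum_(s : k.+1.-tuple T) occurrences s w + k)%N.
Proof.
suff : (\sum_(s : k.+1.-tuple T) occurrences s w <= size w
   <= \sum_(s : k.+1.-tuple T) occurrences s w + minn (size w) k)%N by lia.
elim: w => [|a w IH]; first by rewrite big1.
under eq_bigr do rewrite occurrences_cons.
rewrite big_split/=.
(* Exactly one tuple is a prefix of [a :: w], provided that [k.+1] letters remain. *)
suff -> : (\sum_(s : k.+1.-tuple T) prefix s (a :: w) = (k <= size w)%N)%N.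
  by move: IH; case: (leqP k (size w)) => /=; lia.
have [kw|wk] := leqP k (size w).
  have sz : size (take k.+1 (a :: w)) == k.+1 by rewrite size_takel.
  rewrite (bigD1 (Tuple sz)) // big1 => [|s /negPf ns].
    by rewrite [LHS]addn0 prefixE size_tuple/= eqxx.
  by rewrite prefixE size_tuple eq_sym -[X in (_ == X)]/(val (Tuple sz)) (inj_eq val_inj) ns.
rewrite big1// => s _; rewrite prefixE size_tuple.
case: eqP => // /(congr1 size); rewrite size_tuple take_oversize/=; lia.
Qed.

(** Since [p] has mass 1, summing the approximate counts over all tuples shows that the length of
    [w] is close to [M], so dividing by it instead of [M] costs little. *)
Lemma circulation_word (R : realType) (T : finType) (k : nat) (p : k.+1.-tuple T -> R)
    (eps : R) :
  (forall s, 0 <= p s) -> circulation k p -> \sum_s p s = 1 -> 0 < eps ->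
  exists w : seq T, [/\ (0 < size w)%N, k.+1%:R / (size w)%:R <= eps &
    forall s : k.+1.-tuple T, `|(occurrences s w)%:R / (size w)%:R - p s| <= eps].
Proof.
move=> p0 pc p1 eps0.
set c : R := #|{: k.+1.-tuple T}|%:R; have c0 : 0 <= c by [].
(* The cap at 1 ensures that [w] has length at least [M / 2]. In [delta], [c] pays for the error
   summed over all tuples and 3 for the remaining errors of size [delta * M]. *)
pose eps' := Num.min eps 1.
have [e0 e1 e2] : [/\ 0 < eps', eps' <= 1 & eps' <= eps].
  by rewrite /eps' lt_min eps0 ltr01 !ge_min !lexx orbT.
pose delta := eps' / (8%:R * (c + 3%:R)).
have dE : (c + 3%:R) * delta = eps' / 8%:R by rewrite /delta; field; lra.
have d0 : 0 < delta by rewrite divr_gt0// mulr_gt0// ltr_wpDl.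
have [M1 M1P] := circulation_approximable k p p0 pc _ d0.
have [M2 M2P] := large_nat k.+1%:R _ d0.
pose M := (maxn M1 M2).+1.
have [|w wP] := M1P M; first by rewrite /M leqW// leq_maxl.
have kM : k.+1%:R <= delta * M%:R by apply: M2P; rewrite /M leqW// leq_maxr.
have M0 : 0 < M%:R :> R by rewrite ltr0n.
have p_le1 s : p s <= 1 by rewrite -p1 (bigD1 s)//= lerDl sumr_ge0.
have /andP[] := sum_occurrences T k w.
rewrite -!(ler_nat R) natrD natr_sum; set S := \sum_s _ => SL LS.
have SM : `|S - M%:R| <= c * (delta * M%:R).
  have ME : M%:R = \sum_s M%:R * p s by rewrite -mulr_sumr p1 mulr1.
  rewrite [X in `|_ - X|]ME -sumrB.
  rewrite (le_trans (ler_norm_sum _ _ _))// [leRHS]mulr_natl -sumr_const.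
  by apply: ler_sum => s _; exact: wP.
have kS : k%:R + 1 = k.+1%:R :> R by rewrite natr1.
set L : R := (size w)%:R in SL LS *.
set dM := delta * M%:R in kM SM wP *.
have dM0 : 0 < dM by rewrite mulr_gt0.
have dME : c * dM + 3%:R * dM = eps' / 8%:R * M%:R by rewrite -dE /dM; ring.
have eM : eps' * M%:R <= 1 * M%:R by rewrite ler_pM2r.
have cdM : 0 <= c * dM by rewrite mulr_ge0// ltW.
have LM : `|M%:R - L| <= c * dM + dM.
  by move: SM; rewrite !ler_norml => /andP[? ?]; apply/andP; split; lra.
have LM2 : M%:R / 2%:R <= L by move: LM; rewrite ler_norml => /andP[? ?]; lra.
have L0 : 0 < L by lra.
have eL : eps' * M%:R <= 2%:R * (eps * L).
  have h : eps' * M%:R <= eps * M%:R by rewrite ler_pM2r.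
  have h' : eps * (M%:R / 2%:R) <= eps * L by rewrite ler_pM2l.
  lra.
exists w; split; first by rewrite -(ltr0n R).
  by rewrite ler_pdivrMr//; lra.
move=> s.
have -> : (occurrences s w)%:R / L - p s =
    ((occurrences s w)%:R - M%:R * p s + p s * (M%:R - L)) / L.
  by field; rewrite gt_eqF.
rewrite normrM (gtr0_norm (_ : 0 < L^-1)) ?invr_gt0// ler_pdivrMr//.
rewrite (le_trans (ler_normD _ _))//.
have : `|p s * (M%:R - L)| <= 1 * (c * dM + dM).
  by rewrite normrM ger0_norm// ler_pM.
have := wP s; lra.
Qed.

(** * Generic points *)

Definition frequency_hits (R : realType) (m : nat -> nat) (b k : nat)
    (w : seq nat) (N : nat) : set R :=
  [set x | exists2 j, (N <= j)%N & forall n, (m j <= n < m j.+1)%N ->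
     forall s : k.-tuple 'I_b,
      `|freq b k x s n - (occurrences (letters b k s) w)%:R / (size w)%:R|
        <= k%:R / (size w)%:R + N.+1%:R^-1].

(** A third of [eps] each goes to approximating [p] by the frequencies of a word [w], to the
    junction error of its copies, and to [N.+1%:R^-1]. The neighborhood is then visited along entire
    intervals, arbitrarily late. *)
Lemma Delta_sub_Gamma (R : realType) (m : nat -> nat) (b k : nat) (x : R)
    (I : set (set nat)) :
  (forall A : set nat, (forall N, exists2 j, (N <= j)%N &
     forall i, (m j <= i < m j.+1)%N -> A i) -> ~ I A) ->
  (forall w N, (0 < size w)%N -> all (fun i => i < b)%N w ->
     frequency_hits R m b k.+1 w N x) ->
  Delta R b k.+1 `<=` Gamma b k.+1 x I.
Proof.
move=> mI hits p /= [p1 p0 pc] U oU Up; apply: mI => N.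
have [eps eps0 epsU] := ptws_nbhs_box R _ p U (open_nbhs_nbhs (conj oU Up)).
have circ : circulation k p.
  move=> s; rewrite -(eq_bigr _ (fun a _ => pseq_tuple b k.+1 p _)).
  by rewrite pc; apply: eq_bigr => a _; rewrite -pseq_tuple.
have e3 : 0 < eps / 3%:R by rewrite divr_gt0.
have [w [w0 kw wP]] := circulation_word R _ k p _ p0 circ p1 e3.
have [M MP] := large_nat 1 _ e3.
have [||j Nj jP] := hits (map val w) (maxn N M); first by rewrite size_map.
  by rewrite all_map; apply/allP => i _ /=.
exists j; first by rewrite (leq_trans _ Nj)// leq_maxl.
move=> n nj; apply: epsU => s; have := jP n nj s.
rewrite size_map /letters occurrences_map; last exact: val_inj.
have M_inv : (maxn N M).+1%:R^-1 <= eps / 3%:R.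
  by rewrite -[leLHS]mul1r ler_pdivrMr//; apply: MP; rewrite leqW// leq_maxr.
move=> h; rewrite (_ : eps = eps / 3%:R + eps / 3%:R + eps / 3%:R); last by field.
rewrite -[freq_vec _ _ _ _ s](subrK ((occurrences s w)%:R / (size w)%:R)) -addrA.
by rewrite (le_trans (ler_normD _ _))// lerD// (le_trans h)// lerD.
Qed.

Theorem theorem2p1 (R : realType) (I : set (set nat)) :
  is_ideal I -> meager_ideal I ->
  @comeager_in R `]0, 1]%classic
    [set x : R | forall b k : nat, (2 <= b)%N -> (1 <= k)%N ->
                 Gamma b k x I = Delta R b k].
Proof.
move=> idI /(meager_ideal_intervals I idI)[m [mS mI]].
(* Letters are natural numbers so that all bases share one countable index type. The conditions on
   [b] and [w] sit inside the set, so an inadmissible index imposes nothing. *)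
pose H (i : nat * nat * seq nat * nat) : set R := let: (b, k, w, N) := i in
  [set x | (1 < b)%N -> (0 < size w)%N -> all (fun i => i < b)%N w ->
    frequency_hits R m b k w N x].
pose F n : set R := `]0, 1]%classic `\` (if unpickle n is Some i then H i else setT).
exists F; split=> [n|x [/= Dx nx]].
  apply: subspace_nowhere_dense => a c a0 ac c1.
  have trivial_case (P : set R) : (forall x, P x) ->
      exists y z, y < z /\ forall x, y < x < z -> a < x < c /\ P x.
    by move=> Px; exists a, c; split.
  case: (unpickle n) => [[[[b k] w] N]|]; last exact: trivial_case.
  have [/and3P[b1 w0 wb]|nP] := boolP [&& (1 < b)%N, (0 < size w)%N
    & all (fun i => i < b)%N w].
    have [y [z [yz yzP]]] := frequency_interval b b1 k w m N a c w0 wb mS a0 ac c1.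
    by exists y, z; split=> // x /yzP[xac hx]; split.
  apply: trivial_case => x /= b1 w0 wb.
  by rewrite b1 w0 wb in nP.
apply: contrapT => nF; apply: nx => b [//|k] b1 _.
have x_unit : 0 < x <= 1 by move: Dx; rewrite in_itv.
apply/seteqP; split; first exact: Gamma_sub_Delta.
apply: (Delta_sub_Gamma _ m) => // w N w0 wb; apply: contrapT => nhits.
apply: nF; exists (pickle (b, k.+1, w, N)) => //; rewrite /F pickleK.
by split=> // /(_ b1 w0 wb).
Qed.
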